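(* The closed unit ball $B_{L_\infty}$ of $L_\infty[0,1]$ is an $\mathbf{a}$-thin subset of $L_1[0,1]$ for $\mathbf{a}=(a_n)_{n\in\mathbb{N}}$ with $a_n=e^{-16^n}$.
   Context: $[0,1]$ carries Lebesgue measure. For a null sequence $\mathbf{a}=(a_n)$ of positive reals, a non-empty bounded convex symmetric subset $W$ of a Banach space $X$ is $\mathbf{a}$-thin if for every infinite dimensional closed subspace $Y$ of $X$, $\sup_n\sup_{y\in B_Y}\|y\|_n=\infty$, where $\|\cdot\|_n$ is the Minkowski gauge of the set $2^nW+a_nB_X$ and $B_Y$, $B_X$ are closed unit balls. *)

(* Defs.v *)
From HB Require Import structures.
From mathcomp Require Import all_boot all_order all_algebra.
From mathcomp Require Import all_classical all_reals all_analysis.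
From mathcomp Require Import measurable_realfun ess_sup_inf.
From mathcomp Require Import ring lra.

Set Implicit Arguments.
Unset Strict Implicit.
Unset Printing Implicit Defensive.
Import Order.TTheory GRing.Theory Num.Theory numFieldNormedType.Exports.

Local Open Scope classical_set_scope.
Local Open Scope ring_scope.
Local Open Scope quotient_scope.

(* The library defines the type [LspaceType mu p1] of classes of a.e. equal
   functions with finite L^p norm, but gives it no structure. We make it a
   normed module over [R] under the L^p norm, and [LspaceType1 mu] a complete
   one (Riesz-Fischer). *)

Section Lspace_normed_module.
Context d (T : measurableType d) (R : realType).
Variables (mu : {measure set T -> \bar R}) (p : \bar R) (p1 : (1 <= p)%E).

Local Notation Lfun := (LfunType mu p1).
Local Notation L := (LspaceType mu p1).

HB.instance Definition _ := gen_eqMixin L.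
HB.instance Definition _ := gen_choiceMixin L.

Lemma eq_ae_Lnorm (f g : T -> R) : measurable_fun setT f -> measurable_fun setT g ->
  f = g %[ae mu] -> Lnorm mu p (EFin \o f) = Lnorm mu p (EFin \o g).
Proof.
move=> mf mg fg; rewrite unlock /Lnorm; case: p p1 => [r r1| _ |//].
  have mp (h : T -> R) : measurable_fun [set: T] h ->
      measurable_fun [set: T] ((@poweR R)^~ r \o (abse \o (EFin \o h))).
    move=> mh; apply: (measurableT_comp (measurable_poweR _)).
    by apply: measurableT_comp => //; exact/measurable_EFinP.
  congr poweR; apply: ge0_ae_eq_integral => //.
  - exact: mp.
  - exact: mp.
  - by move=> x _; exact: poweR_ge0.
  - by move=> x _; exact: poweR_ge0.
  - by apply: filterS fg => x /(_ I)/= ->.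
case: ifPn => // _; apply: eq_ess_sup.
by apply: filterS fg => x /(_ I)/= ->.
Qed.

Definition cls (f : {mfun T >-> measurableTypeR R}) : {mfun_ mu, T >-> measurableTypeR R} :=
  \pi f.

Lemma repr_cls (f : {mfun T >-> measurableTypeR R}) : repr (cls f) = f %[ae mu].
Proof.
apply: asboolW.
have : (repr (cls f) == f %[mod {mfun_ mu, T >-> measurableTypeR R}]).
  by rewrite reprK.
by rewrite eqmodE.
Qed.

(* [R] and [measurableTypeR R] have the same measurable sets but distinct
   displays, hence the two conversions below. *)
Section mfunR.
Variable f : {mfun T >-> R}.
Definition mfunR : T -> measurableTypeR R := f.
Let mfunR_measurable : measurable_fun setT mfunR.
Proof. exact: (@measurable_funPT _ _ _ _ f). Qed.
HB.instance Definition _ := isMeasurableFun.Build _ _ T (measurableTypeR R) mfunR mfunR_measurable.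
End mfunR.

Lemma cls_finite (f : Lfun) : finite_norm mu p (cls (mfunR f)).
Proof.
rewrite /finite_norm (@eq_ae_Lnorm _ f) //.
- exact: Lfunction_finite.
- exact: (@measurable_funPT _ _ _ _ (repr (cls (mfunR f)))).
- exact: repr_cls.
Qed.

HB.instance Definition _ (f : Lfun) := isFinLebesgue.Build _ _ _ _ _ p1 (cls (mfunR f)) (cls_finite f).
Definition to_L (f : Lfun) : L := cls (mfunR f).

Section of_L.
Variable f : L.
Definition of_L_fun : T -> R := f.
Let of_L_measurable : measurable_fun setT of_L_fun.
Proof. exact: (@measurable_funPT _ _ _ _ (repr (f : {mfun_ mu, T >-> measurableTypeR R}))). Qed.
HB.instance Definition _ := isMeasurableFun.Build _ _ T R of_L_fun of_L_measurable.
Let of_L_finite : finite_norm mu p of_L_fun.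
Proof. exact: Lebesgue_finite. Qed.
HB.instance Definition _ := isLfunction.Build _ T R mu p p1 of_L_fun of_L_finite.
Definition of_L : Lfun := of_L_fun.
End of_L.

Lemma Leq (f g : L) : f = g :> {mfun_ mu, T >-> measurableTypeR R} -> f = g.
Proof.
case: f g => [f [[hf]]] [g [[hg]]] /= fg; subst g.
by rewrite (Prop_irrelevance hf hg).
Qed.

Lemma to_LP (f g : Lfun) : f = g %[ae mu] -> to_L f = to_L g.
Proof.
move=> fg; apply: Leq; apply/eqP; rewrite eqmodE.
exact/asboolP.
Qed.

Lemma of_LK : cancel of_L to_L.
Proof.
move=> f; apply: Leq; rewrite -[RHS]reprK; apply/eqP; rewrite eqmodE.
by apply/asboolP; exact: aeW.
Qed.

Lemma to_LK f : of_L (to_L f) = f %[ae mu].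
Proof. exact: repr_cls. Qed.

Definition addL (f g : L) := to_L (of_L f + of_L g).
Definition oppL (f : L) := to_L (- of_L f).
Definition scaleL (a : R) (f : L) := to_L (a *: of_L f).

Lemma LfunD (f g : Lfun) x : (f + g) x = f x + g x.
Proof. by []. Qed.

Lemma LfunN (f : Lfun) x : (- f) x = - f x.
Proof. by []. Qed.

Lemma LfunZ a (f : Lfun) x : (a *: f) x = a * f x.
Proof. by []. Qed.

Lemma to_LD (f g : Lfun) : to_L (f + g) = addL (to_L f) (to_L g).
Proof.
apply: to_LP; apply: filterS2 (to_LK f) (to_LK g) => x fx gx _.
by rewrite !LfunD fx// gx.
Qed.

Lemma to_LN (f : Lfun) : to_L (- f) = oppL (to_L f).
Proof.
by apply: to_LP; apply: filterS (to_LK f) => x fx _; rewrite !LfunN fx.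
Qed.

Lemma to_LZ a (f : Lfun) : to_L (a *: f) = scaleL a (to_L f).
Proof.
by apply: to_LP; apply: filterS (to_LK f) => x fx _; rewrite !LfunZ fx.
Qed.

Let addLA : associative addL.
Proof.
move=> f g h; rewrite -(of_LK f) -(of_LK g) -(of_LK h).
by rewrite -!to_LD addrA.
Qed.

Let addLC : commutative addL.
Proof. by move=> f g; rewrite /addL addrC. Qed.

Let add0L : left_id (to_L 0) addL.
Proof. by move=> f; rewrite -(of_LK f) -to_LD add0r. Qed.

Let addNL : left_inverse (to_L 0) oppL addL.
Proof. by move=> f; rewrite -(of_LK f) -to_LN -to_LD addNr. Qed.

HB.instance Definition _ := GRing.isZmodule.Build L addLA addLC add0L addNL.

Let scaleLA a b (f : L) : scaleL a (scaleL b f) = scaleL (a * b) f.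
Proof. by rewrite -(of_LK f) -!to_LZ scalerA. Qed.

Let scale1L : left_id 1 scaleL.
Proof. by move=> f; rewrite -(of_LK f) -!to_LZ scale1r. Qed.

Let scaleLDr : right_distributive scaleL +%R.
Proof.
move=> a f g; rewrite -(of_LK f) -(of_LK g) [X in scaleL _ X]/GRing.add/=.
by rewrite -to_LD -!to_LZ scalerDr to_LD.
Qed.

Let scaleLDl (f : L) : {morph scaleL^~ f : a b / a + b}.
Proof. by move=> a b; rewrite -(of_LK f) -!to_LZ scalerDl to_LD. Qed.

HB.instance Definition _ :=
  GRing.Zmodule_isLmodule.Build R L scaleLA scale1L scaleLDr scaleLDl.

Definition normL (f : L) : R := fine ('N[mu]_p[EFin \o f])%E.

Lemma normL_to_L (f : Lfun) : normL (to_L f) = fine ('N[mu]_p[EFin \o f])%E.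
Proof.
congr fine; apply: eq_ae_Lnorm => //; last exact: repr_cls.
exact: (@measurable_funPT _ _ _ _ (of_L (to_L f))).
Qed.

Let normLD (f g : L) : normL (f + g) <= normL f + normL g.
Proof. by rewrite normL_to_L; exact: ler_LnormD. Qed.

Let normLZ a (f : L) : normL (a *: f) = `|a| * normL f.
Proof.
rewrite normL_to_L; apply: EFin_inj; rewrite EFinM.
apply: (etrans (finite_norm_fine (a *: of_L f))).
rewrite [X in (_ * X)%E](finite_norm_fine (of_L f)).
exact: (LnormZ (of_L f) a).
Qed.

Let normL_eq0 (f : L) : normL f = 0 -> f = 0.
Proof.
move=> f0; rewrite -(of_LK f); apply: to_LP.
exact: (@fine_Lnormr_eq0 _ _ _ mu p p1 (of_L f)).
Qed.

HB.instance Definition _ :=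
  Lmodule_isNormed.Build R L normLD normLZ normL_eq0.

Lemma Lspace_normE (f : L) : (`|f|%:E = 'N[mu]_p[EFin \o f])%E.
Proof. exact: (finite_norm_fine (of_L f)). Qed.

Lemma Lspace_addE (f g : L) : f + g = (fun x => f x + g x) %[ae mu].
Proof. exact: (to_LK (of_L f + of_L g)). Qed.

Lemma Lspace_scaleE a (f : L) : a *: f = (fun x => a * f x) %[ae mu].
Proof. exact: (to_LK (a *: of_L f)). Qed.

End Lspace_normed_module.

Section L1_complete.
Context d (T : measurableType d) (R : realType).
Variables (mu : {measure set T -> \bar R}).

Local Notation Lfun := (LfunType mu (@lexx _ _ 1%E)).
Local Notation L := (LspaceType1 mu).

Lemma L1_normE (f : Lfun) : (`|to_L f : L|)%:E = (\int[mu]_x `|f x|%:E)%E.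
Proof.
rewrite -[LHS]/(normL (to_L f))%:E normL_to_L finite_norm_fine Lnorm1.
exact: eq_integral.
Qed.

Lemma L1_distE (f g : Lfun) :
  (`|to_L f - to_L g : L|)%:E = (\int[mu]_x `|f x - g x|%:E)%E.
Proof.
rewrite -[- to_L g]/(oppL (to_L g)) -to_LN.
by rewrite -[to_L f + _]/(addL (to_L f) (to_L (- g))) -to_LD L1_normE.
Qed.

Lemma L1_cvg_subseq (f : nat -> Lfun) :
  (forall n, \int[mu]_x `|f n.+1 x - f n x|%:E <= (2 / (2 ^ (n + 1))%:R)%:E)%E ->
  exists F : Lfun, ((\int[mu]_x `|f n x - F x|%:E)%E @[n --> \oo] --> 0%E).
Proof.
move=> fle.
have mf n : measurable_fun [set: T] (f n).
  exact: (@measurable_funPT _ _ _ _ (f n)).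
pose D n (x : T) : \bar R := `|f n.+1 x - f n x|%:E.
have mD n : measurable_fun [set: T] (D n).
  apply/measurable_EFinP; apply: measurableT_comp => //.
  exact: measurable_funB.
have D0 n x : (0 <= D n x)%E by rewrite lee_fin.
pose g (x : T) : \bar R := (\sum_(0 <= n <oo) D n x)%E.
have mg : measurable_fun [set: T] g by exact: ge0_emeasurable_sum.
have g0 x : (0 <= g x)%E by exact: nneseries_ge0.
have ig : mu.-integrable [set: T] g.
  apply/integrableP; split=> //.
  rewrite (eq_integral g); last by move=> x _; rewrite gee0_abs.
  rewrite integral_nneseries//.
  apply: (@le_lt_trans _ _ (2%:E)%E); last exact: ltry.
  have /cvg_lim h := @cvg_geometric_eseries_half R 2 0.
  have <- : (limn (eseries (fun k => (2 / (2 ^ (k + 1))%:R)%:E)) = 2%:E :> \bar R)%E.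
    by rewrite h// expr0 divr1.
  apply: lee_nneseries => [n _ _|n _]; [by apply: integral_ge0 => x _; exact: D0|exact: fle].
have if0 : mu.-integrable [set: T] (fun x => (`|f 0%N x|)%:E).
  apply/integrableP; split.
    by apply/measurable_EFinP; exact: measurableT_comp.
  under eq_integral do rewrite /= normr_id.
  by rewrite -L1_normE ltry.
pose h (x : T) : \bar R := (`|f 0%N x|%:E + g x)%E.
have ih : mu.-integrable [set: T] h by exact: integrableD.
pose F (x : T) : R := fine (limn_esup (fun n => (f n x)%:E)).
have mF : measurable_fun [set: T] F.
  apply: (measurableT_comp (@fine_measurable R setT _)) => //.
  by apply: measurable_fun_limn_esup => n; exact/measurable_EFinP.
have partial n x : (\sum_(0 <= k < n) `|telescope (f ^~ x) k|)%:E%R = (\sum_(0 <= k < n) D k x)%E.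
  by rewrite -sumEFin.
have partial_le n x : ((\sum_(0 <= k < n) `|telescope (f ^~ x) k|)%:E <= g x)%E.
  by rewrite partial; exact: nneseries_lim_ge.
have fh n x : ((`|f n x|)%:E <= h x)%E.
  rewrite (eq_sum_telescope (f ^~ x) n).
  apply: (@le_trans _ _ (`|f 0%N x|%:E + (\sum_(0 <= k < n) `|telescope (f ^~ x) k|)%:E)%E).
    rewrite -EFinD lee_fin (le_trans (ler_normD _ _))// lerD2l.
    by rewrite seriesEnat/= ler_norm_sum.
  by rewrite leeD2l.
have fF : {ae mu, forall x, [set: T] x -> (f n x)%:E @[n --> \oo] --> (F x)%:E}.
  apply: filterS (integrable_ae measurableT ig) => x /(_ I) gfin _.
  have cvgf : cvgn (fun n => f n x).
    rewrite (_ : (fun n => f n x) = (fun n => f 0%N x + series (telescope (f ^~ x)) n)); last first.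
      by apply/funext => n; exact: (eq_sum_telescope (f ^~ x)).
    apply: is_cvgD; first exact: is_cvg_cst.
    apply: normed_cvg.
    have nE n : [normed series (telescope (f ^~ x))] n =
        \sum_(0 <= k < n) `|telescope (f ^~ x) k| by [].
    apply: nondecreasing_is_cvgn.
      by apply/nondecreasing_seqP => n; rewrite !nE big_nat_recr//= lerDl.
    exists (fine (g x)) => _ [n _ <-].
    by rewrite nE -lee_fin fineK//; exact: partial_le.
  have cvgE : (f n x)%:E @[n --> \oo] --> (limn (fun n => f n x))%:E.
    by apply: cvg_EFin; [exact: nearW|].
  by rewrite /F (cvg_limn_einf_sup cvgE).2.
have [|||iF F0 _] := dominated_convergence (mu := mu) measurableT
  (f_ := fun n x => (f n x)%:E) (f := EFin \o F) (g := h) _ _ fF ih _.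
- by move=> n; exact/measurable_EFinP.
- exact/measurable_EFinP.
- by apply: aeW => x n _ ; exact: fh.
have FL : F \in hoelder.Lfun mu 1 by apply/Lfun1_integrable.
exists (Lfun_Sub (@lexx _ _ 1%E) FL).
exact: F0.
Qed.

Lemma L1_cauchy_cvg (F : set_system L) : ProperFilter F -> cauchy F -> cvg F.
Proof.
move=> FF /cauchyP F_ex.
have e0 n : 0 < (2 ^ (n + 2))%:R^-1 :> R by rewrite invr_gt0 ltr0n expn_gt0.
have [u Fu] : {u : nat -> L & forall n, F (ball (u n) (2 ^ (n + 2))%:R^-1)}.
  by apply: (@choice _ _ (fun n v => F (ball v (2 ^ (n + 2))%:R^-1))) => n; exact: F_ex.
have udist n m : `|u n - u m| <= (2 ^ (n + 2))%:R^-1 + (2 ^ (m + 2))%:R^-1.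
  have [v []] := filter_ex (filterI (Fu n) (Fu m)).
  rewrite -!ball_normE /= => vn vm.
  rewrite (le_trans (ler_distD v _ _))// lerD// ltW//.
  by rewrite distrC.
pose f n := of_L (u n).
have [n|G fG] := L1_cvg_subseq (f := f).
  rewrite -L1_distE !of_LK lee_fin (le_trans (udist _ _))//.
  rewrite addSn expnS natrM invfM [(n + 2)%N]addnS expnS natrM invfM.
  have : 0 <= (2 ^ (n + 1))%:R^-1 :> R by rewrite invr_ge0.
  by lra.
apply/cvg_ex; exists (to_L G : L).
apply/cvgrPdist_lt => e egt0.
have uG : `|u n - to_L G| @[n --> \oo] --> (0 : R).
  suff : (`|u n - to_L G|)%:E @[n --> \oo] --> (0 : R)%:E by move/fine_cvg.
  apply: cvg_trans fG; apply: near_eq_cvg; apply: nearW => n.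
  by rewrite -L1_distE of_LK.
have e20 : 0 < e / 2 by rewrite divr_gt0.
near \oo => n.
have un1 : `|u n - to_L G| < e / 2.
  near: n; have /cvgr0Pnorm_lt/(_ _ e20) := uG.
  by apply: filterS => n; rewrite normr_id.
have un2 : (2 ^ (n + 2))%:R^-1 < e / 2.
  apply: (@le_lt_trans _ _ (1 / 2 ^+ n)).
    rewrite div1r natrX lef_pV2 ?posrE ?exprn_gt0//.
    by rewrite ler_eXn2l ?ltr1n// leq_addr.
  by near: n; exact: (near_infty_natSinv_expn_lt (PosNum e20)).
apply: filterS (Fu n) => v; rewrite -ball_normE /= => unv.
apply: (le_lt_trans (ler_distD (u n) _ _)).
by rewrite (splitr e) ltrD// ?(lt_trans unv)// distrC.
Unshelve. all: by end_near. Qed.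

HB.instance Definition _ := NormedModule.on L.
HB.instance Definition _ := Uniform_isComplete.Build L L1_cauchy_cvg.

End L1_complete.

Section thin.
Context (R : realType).

Definition closed_unit_ball (X : normedModType R) : set X :=
  [set x | `|x| <= 1].

Definition symmetric_set (X : lmodType R) (W : set X) :=
  forall x, W x -> W (- x).

Definition finite_dimensional (X : lmodType R) (Y : set X) :=
  exists n (v : 'I_n -> X), (forall i, Y (v i)) /\
    forall y, Y y -> exists c : 'I_n -> R, y = \sum_(i < n) c i *: v i.

Definition closed_subspace (X : normedModType R) (Y : set X) :=
  GRing.submod_closed (mem Y) /\ closed Y.

(* Extended-real valued: +oo where no dilate of [A] contains [x]. *)
Definition minkowski_gauge (X : lmodType R) (A : set X) (x : X) : \bar R :=
  ereal_inf [set t%:E |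
    t in [set t : R | 0 < t /\ [set t *: z | z in A] x]].

(* The gauge of [2 ^ n W + a_n B_X]. *)
Definition thin_norm (X : normedModType R) (a : R^nat) (W : set X) (n : nat)
    : X -> \bar R :=
  minkowski_gauge [set 2 ^+ n *: w + a n *: b |
    w in W & b in @closed_unit_ball X].

Definition null_positive (a : R^nat) :=
  (forall n, 0 < a n) /\ a @ \oo --> (0 : R).

Definition thin (X : completeNormedModType R) (a : R^nat) (W : set X) :=
  [/\ null_positive a,
      [/\ W !=set0, bounded_set W, convex_set (W : set (convex_lmodType X))
        & symmetric_set W]
    & forall Y : set X, closed_subspace Y -> ~ finite_dimensional Y ->
      ereal_sup [set ereal_sup
          [set thin_norm a W n y | y in Y `&` @closed_unit_ball X] |
        n in [set: nat]] = +oo%E].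

End thin.

Section L1_01.
Context (R : realType).

(* Lebesgue measure on [0, 1], as the measure A |-> lambda (A `&` [0, 1]) on
   the line: classes modulo this measure only depend on the values on [0, 1]. *)
Definition lebesgue01 : {measure set (measurableTypeR R) -> \bar R} :=
  mrestr lebesgue_measure (measurable_itv `[0 : R, 1]).

Definition L1_01 : completeNormedModType R := LspaceType1 lebesgue01.

Definition Linfty_01 : normedModType R :=
  LspaceType lebesgue01 (leey (1%E : \bar R)).

(* An element of L_1 is in B_(L_oo) if, as a class of a.e. equal functions, it
   is an element of the unit ball of L_oo. *)
Definition Linfty_ball : set L1_01 :=
  [set f | exists2 g : Linfty_01, closed_unit_ball g &
    (f : LspaceType1 lebesgue01) =
    (g : LspaceType lebesgue01 (leey (1%E : \bar R)))
      :> {mfun_ lebesgue01, _ >-> measurableTypeR R}].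

End L1_01.

(* Main.v *)
Require Import Defs.
From mathcomp Require Import all_boot all_order all_algebra.
From mathcomp Require Import all_classical all_reals all_analysis.
From mathcomp Require Import measurable_realfun ess_sup_inf.
From mathcomp Require Import ring lra.

Set Implicit Arguments.
Unset Strict Implicit.
Unset Printing Implicit Defensive.
Import Order.TTheory GRing.Theory Num.Theory numFieldNormedType.Exports.

Local Open Scope classical_set_scope.
Local Open Scope ring_scope.

(** Suppose that the gauges are bounded by [C] on the unit ball of an infinite
    dimensional subspace [Y] of L^1. Then, with a slightly larger [C], every [y]
    in that unit ball satisfies, for every [n], [`|y| <= C * 2 ^+ n + `|v|]
    almost everywhere for some [v] of L^1 norm at most [C * a n] (predicate
    [splits]). Two consequences of this contradict each other.

    First, the decay of [a] makes [Y] a subspace of L^2 on which the L^2 norm is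
    at most a constant times the L^1 norm: on the set where [`|y|] is comparable
    to [2 ^+ n], the square of [y] is controlled by [2 ^+ n * `|v|], and these
    contributions are summable ([splits_second_moment]). So [Y] contains
    arbitrarily large families orthonormal in L^2 ([gram_schmidt]), whose members
    have L^1 norm bounded below by a constant depending only on [C].

    Secondly, let [y_1, ..., y_N] be such a family. Each signed sum of the [y_i]
    has L^1 norm at most its L^2 norm, the square root of [N], and therefore
    splits with constant [sqrt N * C]. At each point, the sum of the [`|y_i|] is
    one of the [2 ^ N] signed sums, so it is at most [sqrt N * C * 2 ^+ n] plus the
    [2 ^ N] error terms, whose integrals add up to at most
    [2 ^ N * sqrt N * C * a n] ([sum_norms_le_signs]). For [N = 16 ^ n] the weight
    [a n = expR (- N)] absorbs the factor [2 ^ N], and the L^1 norms of the [y_i]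
    add up to at most a constant times [sqrt N * 2 ^+ n = 8 ^+ n], although they
    add up to at least a constant times [N = 16 ^+ n]. This is impossible for
    large [n] ([splitting_dyadic_bound],
    [splitting_finite_dimensional]).

    The remaining clauses rest on the description of the ball of L^oo as the
    classes bounded by 1 almost everywhere ([Linfty_ballP]). *)

(** * Orthonormal families in an infinite dimensional subspace *)

(** The form is only required to be bilinear, symmetric and definite on [Y]:
    the form it stands for is the L^2 pairing, which is meaningful on a subspace
    of L^1 made of square integrable functions. *)
Section gram_schmidt.
Context (R : realType) (V : lmodType R) (Y : set V) (ip : V -> V -> R).
Hypothesis Y_sub : GRing.submod_closed (mem Y).
Hypothesis ipC : forall u v, Y u -> Y v -> ip u v = ip v u.
Hypothesis ipDl : forall a u v w, Y u -> Y v -> Y w ->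
  ip (a *: u + v) w = a * ip u w + ip v w.
Hypothesis ip_gt0 : forall u, Y u -> u != 0 -> 0 < ip u u.

Lemma subspace0 : Y 0.
Proof. exact/set_mem/Y_sub.1. Qed.

Lemma subspace_lin a u v : Y u -> Y v -> Y (a *: u + v).
Proof. by move=> Yu Yv; apply/set_mem/Y_sub.2; exact/mem_set. Qed.

Lemma subspace_sum N (c : 'I_N -> R) (v : 'I_N -> V) :
  (forall i, Y (v i)) -> Y (\sum_(i < N) c i *: v i).
Proof.
move=> Yv; apply: (big_rec Y) => [|i u _ Yu]; last exact: subspace_lin.
exact: subspace0.
Qed.

Lemma ip0l w : Y w -> ip 0 w = 0.
Proof.
move=> Yw; have Y0 := subspace0; have := ipDl 1 Y0 Y0 Yw.
by rewrite scale1r addr0 mul1r => /eqP; rewrite -subr_eq subrr => /eqP <-.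
Qed.

Lemma ipZl a u w : Y u -> Y w -> ip (a *: u) w = a * ip u w.
Proof. by move=> Yu Yw; rewrite -[_ *: _]addr0 ipDl ?ip0l ?addr0//; exact: subspace0. Qed.

Lemma ip_suml N (c : 'I_N -> R) (v : 'I_N -> V) w :
  (forall i, Y (v i)) -> Y w ->
  ip (\sum_(i < N) c i *: v i) w = \sum_(i < N) c i * ip (v i) w.
Proof.
move=> Yv Yw; elim: N c v Yv => [|N IH] c v Yv.
  by rewrite !big_ord0 ip0l.
rewrite !big_ord_recl ipDl ?IH//.
exact: subspace_sum.
Qed.

Definition orthonormal_family N (v : 'I_N -> V) :=
  forall i j, ip (v i) (v j) = (i == j)%:R.

Lemma ip_orthonormal N (c : 'I_N -> R) (v : 'I_N -> V) :
  (forall i, Y (v i)) -> orthonormal_family v ->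
  ip (\sum_(i < N) c i *: v i) (\sum_(i < N) c i *: v i) = \sum_(i < N) c i ^+ 2.
Proof.
move=> Yv ov; have Ys := subspace_sum c Yv.
rewrite ip_suml//; apply: eq_bigr => i _.
rewrite ipC// ip_suml// (bigD1 i)//= big1 ?addr0 => [|j ji].
  by rewrite ov eqxx mulr1 expr2.
by rewrite ov (negbTE ji) mulr0.
Qed.

(** Gram-Schmidt: an infinite dimensional subspace contains a vector outside
    the span of any [N] of its vectors, whose orthogonal component can be
    normalised. *)
Lemma gram_schmidt : ~ finite_dimensional Y ->
  forall N, exists v : 'I_N -> V, (forall i, Y (v i)) /\ orthonormal_family v.
Proof.
move=> Yinf; elim=> [|N [v [Yv ov]]].
  by exists (fun=> 0); split=> [[]|[]].
have [y [Yy yv]] : exists y, Y y /\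
    forall c : 'I_N -> R, y <> \sum_(i < N) c i *: v i.
  apply: contra_notP Yinf => /forallNP h; exists N, v; split=> // y Yy.
  by apply: contrapT => /forallNP yv; apply: (h y).
pose z := y - \sum_(i < N) ip y (v i) *: v i.
have zE : z = (-1) *: (\sum_(i < N) ip y (v i) *: v i) + y.
  by rewrite scaleN1r addrC.
have Ys := subspace_sum (fun i => ip y (v i)) Yv.
have Yz : Y z by rewrite zE; exact: subspace_lin.
have z0 : z != 0 by apply/eqP => /eqP; rewrite subr_eq0 => /eqP; exact: yv.
have zv i : ip z (v i) = 0.
  rewrite zE ipDl// ip_suml// (bigD1 i)//= big1 ?addr0 => [|j ji].
    by rewrite ov eqxx mulr1 mulN1r addNr.
  by rewrite ov (negbTE ji) mulr0.
pose s := (Num.sqrt (ip z z))^-1.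
have Yw : Y (s *: z).
  by rewrite -[_ *: _]addr0; apply: subspace_lin => //; exact: subspace0.
have ww : ip (s *: z) (s *: z) = 1.
  rewrite ipZl// ipC// ipZl// mulrA -expr2 exprVn sqr_sqrtr ?mulVf//.
    by rewrite gt_eqF ?ip_gt0.
  by rewrite ltW ?ip_gt0.
exists (fun i => oapp v (s *: z) (unlift ord_max i)); split=> [i|i j].
  by case: unliftP => [j|] _ /=.
case: (unliftP ord_max i) => [i'|] ->; case: (unliftP ord_max j) => [j'|] ->;
  rewrite ?liftK ?unlift_none /=.
- by rewrite ov (inj_eq lift_inj).
- by rewrite ipC// ipZl// zv mulr0 eq_sym (negbTE (neq_lift _ _)).
- by rewrite ipZl// zv mulr0 (negbTE (neq_lift _ _)).
- by rewrite eqxx.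
Qed.

End gram_schmidt.

(** * Sign sums and the L^2 pairing on L^1 *)

Section L1_theory.
Context d (T : measurableType d) (R : realType) (mu : {measure set T -> \bar R}).
Local Notation L := (LspaceType1 mu).
Implicit Types (f g : L).

Lemma L1_measurable f : measurable_fun setT (f : T -> R).
Proof. exact: (@measurable_funPT _ _ _ _ (of_L f)). Qed.

Lemma L1_norm_integral f : (`|f|%:E = \int[mu]_x `|f x|%:E)%E.
Proof. by rewrite Lspace_normE Lnorm1. Qed.

Lemma L1_linear_ae a f g : (a *: f + g : L) = (fun x => a * f x + g x) %[ae mu].
Proof.
apply: filterS2 (Lspace_addE (a *: f) g) (Lspace_scaleE a f) => x h1 h2 _.
by rewrite h1// h2.
Qed.

Lemma L1_sum_ae N (c : 'I_N -> R) (v : 'I_N -> L) :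
  (\sum_(i < N) c i *: v i : L) = (fun x => \sum_(i < N) c i * v i x) %[ae mu].
Proof.
elim: N c v => [|N IH] c v.
  rewrite big_ord0; apply: filterS (@L1_linear_ae (-1) 0 0) => x /(_ I) h _.
  by move: h; rewrite scaler0 addr0 mulN1r addNr big_ord0.
rewrite big_ord_recl.
have h0 := L1_linear_ae (c ord0) (v ord0)
  (\sum_(i < N) c (lift ord0 i) *: v (lift ord0 i)).
apply: filterS2 h0 (IH (c \o lift ord0) (v \o lift ord0)) => x h1 h2 _.
by rewrite big_ord_recl h1// h2.
Qed.

Lemma L1_measurable_norm f : measurable_fun setT (fun x => `|f x|%:E).
Proof.
by apply/measurable_EFinP; apply: measurableT_comp => //; exact: L1_measurable.
Qed.

(** Pointwise, the sum of the [`|y i x|] is the largest of the signed sums. When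
    each signed sum is at most [A] up to an error small in L^1, the maximum over
    the [2 ^ N] choices of signs is at most [A] up to the sum of the errors. *)
Lemma sum_norms_le_signs N (y : 'I_N -> L) (A B : R)
    (v : {ffun 'I_N -> bool} -> L) :
  mu setT = 1%E -> 0 <= A ->
  (forall e : {ffun 'I_N -> bool}, {ae mu, forall x,
    `|(\sum_(i < N) (-1) ^+ e i *: y i : L) x| <= A + `|v e x|}) ->
  (forall e, `|v e| <= B) ->
  \sum_(i < N) `|y i| <= A + (2 ^ N)%:R * B.
Proof.
move=> mu1 A0 yv vB; rewrite -lee_fin.
apply: (@le_trans _ _ (\int[mu]_x (A%:E + \sum_(e : {ffun 'I_N -> bool}) `|v e x|%:E))%E).
  have -> : ((\sum_(i < N) `|y i|)%:E = \int[mu]_x (\sum_(i < N) `|y i x|%:E))%E.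
    rewrite -sumEFin ge0_integral_sum// => [|i]; last exact: L1_measurable_norm.
    by apply: eq_bigr => i _; rewrite L1_norm_integral.
  apply: ae_ge0_le_integral => //.
  - by move=> x _; exact: sume_ge0.
  - by apply: emeasurable_sum => i; exact: L1_measurable_norm.
  - by move=> x _; rewrite adde_ge0// sume_ge0.
  - apply: emeasurable_funD => //.
    by apply: emeasurable_sum => e; exact: L1_measurable_norm.
  have yE : {ae mu, forall x (e : {ffun 'I_N -> bool}),
      (\sum_(i < N) (-1) ^+ e i *: y i : L) x = \sum_(i < N) (-1) ^+ e i * y i x}.
    apply: filter_forall => e.
    by apply: filterS (L1_sum_ae (fun i => (-1) ^+ e i) y) => x; exact.
  have yvE := filter_forall (ae_filter_ringOfSetsType mu) yv.
  apply: filterS2 yE yvE => x xE xv _.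
  rewrite !sumEFin -EFinD lee_fin.
  (* these signs attain the maximum at [x] *)
  pose e : {ffun 'I_N -> bool} := [ffun i => y i x < 0].
  have -> : \sum_(i < N) `|y i x| = (\sum_(i < N) (-1) ^+ e i *: y i : L) x.
    by rewrite xE; apply: eq_bigr => i _; rewrite ffunE normrEsign.
  apply: (le_trans (ler_norm _)); apply: (le_trans (xv e)); rewrite lerD2l.
  by rewrite (bigD1 e)//= lerDl sumr_ge0.
rewrite ge0_integralD//=.
- rewrite integral_cst// mu1 mule1 EFinD leeD2l//.
  rewrite ge0_integral_sum// => [|e]; last exact: L1_measurable_norm.
  rewrite (eq_bigr (fun e => `|v e|%:E)) => [|e _]; last by rewrite L1_norm_integral.
  rewrite sumEFin lee_fin.
  apply: (le_trans (ler_sum _ (fun e _ => vB e))).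
  by rewrite sumr_const card_ffun card_bool card_ord mulr_natl.
- by move=> x _; exact: sume_ge0.
- by apply: emeasurable_sum => e; exact: L1_measurable_norm.
Qed.

(** Almost everywhere form of membership of [y] in the sum of the ball of radius
    [C * 2 ^+ n] of L^oo and the ball of radius [C * a n] of L^1, for all [n]:
    only the pointwise bound by the two summands is recorded. *)
Definition splits (C : R) (a : R^nat) (y : L) := forall n, exists v : L,
  `|v| <= C * a n /\ {ae mu, forall x, `|y x| <= C * 2 ^+ n + `|v x|}.

(** If [2 * C * 2 ^+ n < t <= 4 * C * 2 ^+ n], the bounded part accounts for less
    than half of [t], so [t <= 2 * v n] and [t ^+ 2] is controlled by [v n]. *)
Lemma dyadic_shell (C t : R) (v : R^nat) : 0 < C ->
  (forall n, t <= C * 2 ^+ n + v n) -> 0 <= t -> (forall n, 0 <= v n) ->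
  (exists n, t ^+ 2 <= 8 * C * 2 ^+ n * v n) \/ t ^+ 2 <= 4 * C ^+ 2.
Proof.
move=> C0 tv t0 v0.
have ex : exists n, t <= 2 * C * 2 ^+ n.
  have [n tn] : exists n : nat, t / (2 * C) < n%:R.
    by exists (Num.bound (t / (2 * C))); apply: archi_boundP; rewrite divr_ge0// mulr_ge0// ltW.
  exists n; rewrite mulrC -ler_pdivrMr ?mulr_gt0//.
  apply: (le_trans (ltW tn)); rewrite -natrX ler_nat ltnW// ltn_expl//.
case: (ex_minnP ex) => -[|n] tn nmin.
  right; have := ler_pM t0 t0 tn tn; rewrite expr0 mulr1 -!expr2 => /le_trans; apply.
  by rewrite exprMn -natrX.
left; exists n.
have nt : 2 * C * 2 ^+ n < t.
  by rewrite ltNge; apply/negP => /nmin; rewrite ltnn.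
have := tv n; move: nt tn; rewrite exprS.
have : 0 <= 2 ^+ n :> R by [].
move: (v n) (v0 n) => w w0.
set p := 2 ^+ n => p0 nt tn tw.
have t2w : t <= 2 * w by nra.
rewrite expr2; apply: (le_trans (ler_pM t0 t0 t2w tn)).
by lra.
Qed.

(** On the [n]-th dyadic shell of values of [y], [y ^+ 2] is dominated by
    [2 ^+ n] times the integrable part at scale [n]. The integrals over the shells
    are summable as soon as [a] decays at least like [4 ^- n]. *)
Lemma splits_second_moment (C : R) (a : R^nat) (y : L) :
  mu setT = 1%E -> 0 < C -> (forall n, 2 ^+ n * a n <= (2 ^+ n)^-1) ->
  splits C a y -> (\int[mu]_x (y x ^+ 2)%:E <= (20 * C ^+ 2)%:E)%E.
Proof.
move=> mu1 C0 ha /choice [v vP].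
have va n := (vP n).1; have yv n := (vP n).2.
pose h n x : \bar R := ((8 * C * 2 ^+ n)%:E * `|v n x|%:E)%E.
have k0 n : 0 <= 8 * C * 2 ^+ n by rewrite !mulr_ge0// ltW.
have h0 n x : (0 <= h n x)%E by rewrite mule_ge0// lee_fin.
have mh n : measurable_fun setT (h n).
  by apply: emeasurable_funM => //; exact: L1_measurable_norm.
apply: (@le_trans _ _ (\int[mu]_x ((4 * C ^+ 2)%:E + \sum_(0 <= n <oo) h n x))%E).
  apply: ae_ge0_le_integral => //.
  - by move=> x _; rewrite lee_fin sqr_ge0.
  - by apply/measurable_EFinP; apply: measurable_funX; exact: L1_measurable.
  - by move=> x _; rewrite adde_ge0 ?nneseries_ge0// lee_fin mulr_ge0// sqr_ge0.
  - by apply: emeasurable_funD => //; exact: ge0_emeasurable_sum.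
  apply: filterS (ae_foralln yv) => x xv _.
  have [[n]|] := dyadic_shell C0 xv (normr_ge0 _) (fun=> normr_ge0 _);
    rewrite real_normK ?num_real// => yh.
    apply: (@le_trans _ _ (h n x)); first by rewrite /h -EFinM lee_fin.
    apply: (@le_trans _ _ (\sum_(0 <= k <oo) h k x)%E); last first.
      by rewrite leeDr// lee_fin mulr_ge0// sqr_ge0.
    apply: (le_trans _ (nneseries_lim_ge n.+1 _)) => //.
    by rewrite big_nat_recr//= leeDr// sume_ge0.
  by rewrite (@le_trans _ _ (4 * C ^+ 2)%:E) ?lee_fin// leeDl// nneseries_ge0.
rewrite ge0_integralD//=; first last.
- exact: ge0_emeasurable_sum.
- by move=> x _; exact: nneseries_ge0.
- by move=> x _; rewrite lee_fin mulr_ge0// sqr_ge0.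
rewrite integral_cst// mu1 mule1 integral_nneseries//.
have -> : 20 * C ^+ 2 = 4 * C ^+ 2 + 16 * C ^+ 2 by ring.
rewrite EFinD leeD2l//.
have /cvg_lim geo := @cvg_geometric_eseries_half R (16 * C ^+ 2) 0.
rewrite expr0 divr1 in geo; rewrite -geo//.
apply: lee_nneseries => [n _ _|n _]; first exact: integral_ge0.
rewrite ge0_integralZl//; [|exact: L1_measurable_norm|by rewrite lee_fin].
rewrite -L1_norm_integral -EFinM lee_fin addn1 natrX (exprS 2 n).
have := va n; have := ha n; have : 0 < 2 ^+ n :> R by [].
move: (2 ^+ n) => p p0 pa vn.
have q0 : 0 < p^-1 by rewrite invr_gt0.
have -> : 16 * C ^+ 2 / (2 * p) = 8 * C ^+ 2 * p^-1 by field; exact: lt0r_neq0.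
apply: (@le_trans _ _ (8 * C * p * (C * a n))); first by rewrite ler_wpM2l// !mulr_ge0// ltW.
have -> : 8 * C * p * (C * a n) = 8 * C ^+ 2 * (p * a n) by ring.
by rewrite ler_wpM2l// mulr_ge0// sqr_ge0.
Qed.

Definition L2_dot f g : R := (\int[mu]_x (f x * g x))%R.

Definition square_integrable f := (\int[mu]_x (f x ^+ 2)%:E < +oo)%E.

Lemma L2_dotC f g : L2_dot f g = L2_dot g f.
Proof. by apply: eq_Rintegral => x _; rewrite mulrC. Qed.

Lemma integrableM f g : square_integrable f -> square_integrable g ->
  mu.-integrable setT (fun x => (f x * g x)%:E).
Proof.
move=> f2 g2.
have i2 (h : L) : square_integrable h -> mu.-integrable setT (fun x => (h x ^+ 2)%:E).
  move=> h2; apply/integrableP; split.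
    by apply/measurable_EFinP; apply: measurable_funX; exact: L1_measurable.
  rewrite [ltLHS](_ : _ = \int[mu]_x (h x ^+ 2)%:E)%E //; apply: eq_integral => x _.
  by rewrite gee0_abs// lee_fin sqr_ge0.
apply: (le_integrable _ _ _ (integrableD measurableT (i2 _ f2) (i2 _ g2))) => //.
  by apply/measurable_EFinP; apply: measurable_funM; exact: L1_measurable.
move=> x _ /=; rewrite lee_fin [leRHS]ger0_norm ?addr_ge0 ?sqr_ge0//.
rewrite ler_norml; apply/andP; split; nra.
Qed.

Lemma L2_dotDl a f g h : square_integrable f -> square_integrable g ->
  square_integrable h -> L2_dot (a *: f + g) h = a * L2_dot f h + L2_dot g h.
Proof.
move=> f2 g2 h2; have fh := integrableM f2 h2; have gh := integrableM g2 h2.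
rewrite /L2_dot -RintegralZl// -RintegralD//; last exact: (integrableZl measurableT a fh).
congr fine; apply: ae_eq_integral => //.
- by apply/measurable_EFinP; apply: measurable_funM; exact: L1_measurable.
- apply/measurable_EFinP; apply: measurable_funD; [apply: measurable_funM => //|];
  apply: measurable_funM; exact: L1_measurable.
apply: filterS (L1_linear_ae a f g) => x fx _.
by rewrite fx// mulrDl mulrA.
Qed.

Lemma L2_dotE f : square_integrable f -> ((L2_dot f f)%:E = \int[mu]_x (f x ^+ 2)%:E)%E.
Proof.
move=> f2; rewrite /L2_dot /Rintegral fineK; first by apply: eq_integral.
by rewrite ge0_fin_numE// integral_ge0// => x _; rewrite lee_fin -expr2 sqr_ge0.
Qed.

(** Cauchy-Schwarz against the constant 1, integrated from the tangent inequality
    [2 * s * t <= s ^+ 2 + t ^+ 2]. *)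
Lemma L1_norm_le_L2 f (s : R) : mu setT = 1%E -> 0 < s ->
  (\int[mu]_x (f x ^+ 2)%:E <= (s ^+ 2)%:E)%E -> `|f| <= s.
Proof.
move=> mu1 s0 fs; rewrite -lee_fin L1_norm_integral.
have k0 : 0 <= (2 * s)^-1 by rewrite invr_ge0 mulr_ge0// ltW.
have mf2 : measurable_fun setT (fun x => (f x ^+ 2)%:E).
  by apply/measurable_EFinP; apply: measurable_funX; exact: L1_measurable.
apply: (@le_trans _ _ (\int[mu]_x ((s / 2)%:E + (2 * s)^-1%:E * (f x ^+ 2)%:E))%E).
  apply: ge0_le_integral => //.
  - exact: L1_measurable_norm.
  - by apply: emeasurable_funD => //; exact: emeasurable_funM.
  move=> x _; rewrite -EFinM -EFinD lee_fin -[f x ^+ 2]real_normK ?num_real//.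
  move: `|f x| => t; rewrite -subr_ge0.
  have -> : s / 2 + (2 * s)^-1 * t ^+ 2 - t = (2 * s)^-1 * (s - t) ^+ 2 by field; exact: lt0r_neq0.
  by rewrite mulr_ge0// sqr_ge0.
rewrite ge0_integralD//=; first last.
- exact: emeasurable_funM.
- by move=> x _; rewrite -EFinM lee_fin mulr_ge0// sqr_ge0.
- by move=> x _; rewrite lee_fin divr_ge0// ltW.
rewrite integral_cst// mu1 mule1 ge0_integralZl//; last by move=> x _; rewrite lee_fin sqr_ge0.
apply: (@le_trans _ _ ((s / 2)%:E + (2 * s)^-1%:E * (s ^+ 2)%:E)%E).
  by rewrite leeD2l// lee_pmul// integral_ge0// => x _; rewrite lee_fin sqr_ge0.
by rewrite -EFinM -EFinD lee_fin le_eqVlt; apply/orP; left; apply/eqP; field; exact: lt0r_neq0.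
Qed.

End L1_theory.

(** * The unit ball of L^oo and the gauges it defines *)

Section Linfty_ball.
Context (R : realType).
Local Open Scope quotient_scope.
Local Notation mu := (lebesgue01 R).
Local Notation T := (measurableTypeR R).
Local Notation W := (@Linfty_ball R).

Lemma lebesgue01_setT : mu [set: T] = 1%E.
Proof.
rewrite [LHS](_ : _ = lebesgue_measure (`[0 : R, 1]%classic : set R)); last first.
  by congr lebesgue_measure; rewrite setTI.
rewrite lebesgue_measure_itv/= lte_fin ltr01.
by rewrite oppr0 adde0.
Qed.

Lemma Lnorm_infty_le1 (f : T -> R) :
  ('N[mu]_+oo[EFin \o f] <= 1)%E <-> {ae mu, forall x, `|f x| <= 1}.
Proof.
rewrite unlock /Lnorm lebesgue01_setT lte01; split=> [/ess_supP|h].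
  by apply: filterS => x; rewrite /= lee_fin.
by apply/ess_supP; apply: filterS h => x; rewrite /= lee_fin.
Qed.

Lemma Linfty_ballP (f : L1_01 R) :
  W f <-> {ae mu, forall x, `|(f : LspaceType1 mu) x| <= 1}.
Proof.
split=> [[g g1 fg]|f1].
  rewrite fg; apply/Lnorm_infty_le1.
  by move: g1; rewrite /closed_unit_ball/= -lee_fin Lspace_normE.
pose F : T -> R := (f : LspaceType1 mu).
have N1 : ('N[mu]_+oo[EFin \o F] <= 1)%E by exact/Lnorm_infty_le1.
have FL : F \in hoelder.Lfun mu +oo%E.
  rewrite inE; apply/andP; split; rewrite inE/=.
    exact: (@L1_measurable _ _ _ mu f).
  by rewrite /finite_norm (le_lt_trans N1)// ltry.
exists (to_L (Lfun_Sub (leey (1%E : \bar R)) FL) : Linfty_01 R).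
  rewrite /closed_unit_ball/= -lee_fin.
  rewrite -[X in (X <= _)%E]/((normL (to_L (Lfun_Sub (leey 1%E) FL)))%:E).
  rewrite normL_to_L finite_norm_fine//.
rewrite -[LHS]reprK; apply/eqP; rewrite eqmodE.
by apply/asboolP; exact: aeW.
Qed.

(** Absolute convexity, which contains both convexity and symmetry. *)
Lemma Linfty_ball_lin (f g : L1_01 R) (s t : R) : W f -> W g ->
  `|s| + `|t| <= 1 -> W (s *: f + t *: g).
Proof.
move=> /Linfty_ballP f1 /Linfty_ballP g1 st; apply/Linfty_ballP.
have h1 := @L1_linear_ae _ _ _ mu s f (t *: g).
have h2 := @Lspace_scaleE _ _ _ mu _ (lexx _) t g.
apply: filterS2 (filterI h1 h2) (filterI f1 g1) => x [-> // -> //] [fx gx].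
apply: le_trans st; rewrite (le_trans (ler_normD _ _))// !normrM lerD//;
by rewrite ler_piMr.
Qed.

Lemma Linfty_ball_neq0 : W !=set0.
Proof.
exists 0; apply/Linfty_ballP.
apply: filterS (@Lspace_scaleE _ _ _ mu _ (lexx _) 0 (0 : L1_01 R)) => x /(_ I).
by rewrite scaler0 mul0r => ->; rewrite normr0.
Qed.

Lemma Linfty_ball_norm_le1 f : W f -> `|f| <= 1.
Proof.
move=> /Linfty_ballP f1; apply: (L1_norm_le_L2 lebesgue01_setT) => //.
apply: (@le_trans _ _ (\int[mu]_x (cst 1%E x))%E).
  apply: ae_ge0_le_integral => //.
  - by move=> x _; rewrite lee_fin sqr_ge0.
  - by apply/measurable_EFinP; apply: measurable_funX; exact: L1_measurable.
  apply: filterS f1 => x fx _.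
  by rewrite lee_fin -[_ ^+ 2]real_normK ?num_real// expr_le1.
by rewrite integral_cst// lebesgue01_setT mule1 expr1n.
Qed.

Lemma gauge_le_decomposition (X : normedModType R) (a : R^nat) (V : set X) n
    (y : X) (M C : R) : (thin_norm a V n y <= M%:E)%E -> M < C ->
  exists t w b, [/\ 0 < t < C, V w, `|b| <= 1 &
    y = t *: (2 ^+ n *: w + a n *: b)].
Proof.
move=> yM MC.
have : (thin_norm a V n y < C%:E)%E by rewrite (le_lt_trans yM)// lte_fin.
move=> /ereal_inf_lt[_ [t [t0 [z [w Vw [b b1 <-]] <-]] <-]]; rewrite lte_fin => tC.
by exists t, w, b; rewrite t0 tC.
Qed.

Lemma gauge_le_splits (a : R^nat) (C : R) (y : L1_01 R) :
  (forall n, 0 < a n) ->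
  (forall n, (thin_norm a W n y <= C%:E)%E) ->
  splits (C + 1) a (y : LspaceType1 mu).
Proof.
move=> a0 yC n.
have CC : C < C + 1 by rewrite ltrDl.
have [t [w [b [/andP[t0 tC] /Linfty_ballP w1 b1 yE]]]] :=
  gauge_le_decomposition (yC n) CC.
exists ((t * a n) *: b : L1_01 R); split.
  rewrite normrZ gtr0_norm ?mulr_gt0// -[leRHS]mulr1 ler_pM// ?mulr_ge0 1?ltW//.
  by rewrite ltr_pM2r.
have h1 := @L1_linear_ae _ _ _ mu (t * 2 ^+ n) w ((t * a n) *: b).
have -> : y = (t * 2 ^+ n) *: w + (t * a n) *: b :> L1_01 R.
  by rewrite yE scalerDr !scalerA.
apply: filterS2 h1 w1 => x h1 h2.
rewrite h1//; apply: (le_trans (ler_normD _ _)); rewrite lerD2r.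
rewrite normrM -[leRHS]mulr1 ler_pM// gtr0_norm ?mulr_gt0 ?exprn_gt0//.
by rewrite ler_pM2r ?exprn_gt0// ltW.
Qed.
End Linfty_ball.

(** * A subspace whose unit ball splits is finite dimensional *)

(** [a_decay] serves the L^2 bound on [Y] and [a_signs] the sum over all choices
    of signs for [16 ^ n] orthonormal functions. *)
Section splitting_subspace.
Context d (T : measurableType d) (R : realType) (mu : {measure set T -> \bar R}).
Local Notation L := (LspaceType1 mu).
Hypothesis mu1 : mu setT = 1%E.
Variable a : R^nat.
Hypothesis a_decay : forall n, 2 ^+ n * a n <= (2 ^+ n)^-1.
Hypothesis a_signs : forall n, (2 ^ (16 ^ n))%:R * a n <= 1.
Variables (Y : set L) (C : R).
Hypothesis Y_sub : GRing.submod_closed (mem Y).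
Hypothesis C0 : 0 < C.
Hypothesis Y_splits : forall y, Y y -> `|y| <= 1 -> splits C a y.

Lemma splits_scale (s C' : R) (y : L) : 0 <= s -> splits C' a y ->
  splits (s * C') a (s *: y).
Proof.
move=> s0 yC n; have [v [vn yv]] := yC n; exists (s *: v); split.
  by rewrite normrZ ger0_norm// -mulrA ler_wpM2l.
apply: filterS3 (Lspace_scaleE s y) (Lspace_scaleE s v) yv => x -> // -> // h.
by rewrite !normrM ger0_norm// -mulrA -mulrDr ler_wpM2l.
Qed.

Lemma subspace_splits (s : R) (y : L) : Y y -> 0 < s -> `|y| <= s ->
  splits (s * C) a y.
Proof.
move=> Yy s0 ys; rewrite -[y](scalerKV (lt0r_neq0 s0)).
apply: splits_scale (ltW s0) _; apply: Y_splits.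
  rewrite -[_ *: _]addr0; apply: subspace_lin => //.
  exact/set_mem/Y_sub.1.
by rewrite normrZ gtr0_norm ?invr_gt0// mulrC ler_pdivrMr// mul1r.
Qed.

Lemma subspace_second_moment (s : R) (y : L) : Y y -> 0 < s -> `|y| <= s ->
  (\int[mu]_x (y x ^+ 2)%:E <= (20 * (s * C) ^+ 2)%:E)%E.
Proof.
move=> Yy s0 ys; apply: (splits_second_moment mu1 _ a_decay).
  exact: mulr_gt0.
exact: subspace_splits.
Qed.

Lemma subspace_square_integrable (y : L) : Y y -> square_integrable y.
Proof.
move=> Yy; have ys : `|y| <= `|y| + 1 by rewrite lerDl.
by rewrite /square_integrable (le_lt_trans (subspace_second_moment Yy _ ys)) ?ltry// ltr_wpDl.
Qed.

Lemma L2_dot_gt0 (y : L) : Y y -> y != 0 -> 0 < L2_dot y y.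
Proof.
move=> Yy y0; rewrite ltNge; apply/negP => yy.
have n0 : 0 < `|y| by rewrite normr_gt0.
have : `|y| <= `|y| / 2.
  apply: (L1_norm_le_L2 mu1); first by rewrite divr_gt0.
  rewrite -L2_dotE; last exact: subspace_square_integrable.
  by rewrite lee_fin (le_trans yy)// sqr_ge0.
by rewrite leNgt gtr_pMr// invf_lt1// ltr1n.
Qed.

(** Take [N = 16 ^ n] orthonormal functions in [Y]. Their L^1 norms are at least
    [(5 * C)^-1], while their signed sums have L^1 norm at most [4 ^+ n], the
    square root of [N], and so split with constant [4 ^+ n * C]. At scale [n],
    [sum_norms_le_signs] gives [16 ^+ n <= 5 * C * (2 * C * 8 ^+ n)]. *)
Lemma splitting_dyadic_bound n : ~ finite_dimensional Y -> 2 ^+ n <= 10 * C ^+ 2.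
Proof.
move=> Y_inf; pose N := (16 ^ n)%N.
have [|||v [Yv ov]] := @gram_schmidt R L Y (@L2_dot _ _ _ mu) Y_sub _ _ _ Y_inf N.
- by move=> f g _ _; exact: L2_dotC.
- by move=> c f g h Yf Yg Yh; apply: L2_dotDl; exact: subspace_square_integrable.
- exact: L2_dot_gt0.
have v_large i : 1 <= 5 * C * `|v i|.
  rewrite leNgt; apply/negP => small.
  (* otherwise the second moment, which is 1, is at most 20 / 25 *)
  have s0 : 0 < (5 * C)^-1 by rewrite invr_gt0 mulr_gt0.
  have vs : `|v i| <= (5 * C)^-1.
    by rewrite -[leRHS]mul1r ler_pdivlMr ?mulr_gt0// mulrC ltW.
  have := subspace_second_moment (Yv i) s0 vs.
  rewrite -L2_dotE; last exact: subspace_square_integrable.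
  have -> : (5 * C)^-1 * C = 5^-1 by field; exact: lt0r_neq0.
  rewrite ov eqxx lee_fin leNgt => /negP; apply.
  by rewrite exprVn -natrX ltr_pdivrMr ?ltr0n// mul1r ltr_nat.
pose y (e : {ffun 'I_N -> bool}) : L := \sum_(i < N) (-1) ^+ e i *: v i.
have N4 : N%:R = (4 ^+ n) ^+ 2 :> R.
  by rewrite -exprM mulnC exprM -natrX /N natrX.
have p4 : 0 < 4 ^+ n :> R by [].
have Yy e : Y (y e) by exact: subspace_sum.
have y_norm e : `|y e| <= 4 ^+ n.
  apply: (L1_norm_le_L2 mu1) => //.
  rewrite -L2_dotE; last exact: subspace_square_integrable.
  rewrite (ip_orthonormal Y_sub)//; first last.
  - by move=> c f g h Yf Yg Yh; apply: L2_dotDl; exact: subspace_square_integrable.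
  - by move=> f g _ _; exact: L2_dotC.
  under eq_bigr do rewrite sqrr_sign.
  by rewrite sumr_const card_ord N4.
have /choice[w wP] e := subspace_splits (Yy e) p4 (y_norm e) n.
have A0 : 0 <= 4 ^+ n * C * 2 ^+ n by rewrite !mulr_ge0// ltW.
have h := sum_norms_le_signs mu1 A0 (fun e => (wP e).2) (fun e => (wP e).1).
have sumv : 16 ^+ n <= 5 * C * \sum_(i < N) `|v i|.
  rewrite mulr_sumr; apply: (le_trans _ (ler_sum _ (fun i _ => v_large i))).
  by rewrite sumr_const card_ord natrX.
have p2 : 1 <= 2 ^+ n :> R by rewrite exprn_ege1// ler1n.
have {}h : \sum_(i < N) `|v i| <= 2 * C * 4 ^+ n * 2 ^+ n.
  apply: (le_trans h).
  have -> : (2 ^ N)%:R * (4 ^+ n * C * a n) = 4 ^+ n * C * ((2 ^ N)%:R * a n) by ring.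
  rewrite -mulrDr.
  have -> : 2 * C * 4 ^+ n * 2 ^+ n = 4 ^+ n * C * (2 * 2 ^+ n) by ring.
  rewrite ler_wpM2l//; first by rewrite mulr_ge0// ltW.
  rewrite [leRHS]mulr_natl mulr2n.
  by rewrite lerD2l (le_trans (a_signs n)).
move: sumv; have -> : 16 ^+ n = 4 ^+ n * 2 ^+ n * 2 ^+ n :> R.
  by rewrite -!exprMn -!natrM.
have c5 : 0 <= 5 * C by rewrite mulr_ge0// ltW.
move=> /le_trans /(_ (ler_wpM2l c5 h)).
have -> : 5 * C * (2 * C * 4 ^+ n * 2 ^+ n) = 4 ^+ n * 2 ^+ n * (10 * C ^+ 2) by ring.
by rewrite ler_pM2l// mulr_gt0.
Qed.

Lemma splitting_finite_dimensional : finite_dimensional Y.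
Proof.
apply: contrapT => Y_inf.
have := archi_boundP (mulr_ge0 (ler0n R 10) (sqr_ge0 C)).
set m := Num.bound _; rewrite ltNge => /negP; apply.
apply: le_trans (splitting_dyadic_bound m Y_inf).
by rewrite -natrX ler_nat ltnW// ltn_expl.
Qed.

End splitting_subspace.

(** * The weights *)

Section weights.
Context (R : realType).

Definition weight (n : nat) : R := expR (- 16 ^+ n).

Lemma weight_le n : weight n <= (16 ^+ n)^-1.
Proof.
rewrite /weight expRN lef_pV2 ?posrE ?expR_gt0 ?exprn_gt0//.
by rewrite (le_trans _ (expR_ge1Dx _))// lerDr.
Qed.

Lemma weight_decay n : 2 ^+ n * weight n <= (2 ^+ n)^-1.
Proof.
have p0 : 0 < 2 ^+ n :> R by [].
rewrite -ler_pdivlMl// (le_trans (weight_le n))// -invfM -exprMn.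
by rewrite lef_pV2 ?posrE ?exprn_gt0// lerXn2r ?nnegrE// -natrM ler_nat.
Qed.

(** Since [2 <= expR 1], the weight beats the number of choices of [16 ^ n] signs. *)
Lemma weight_signs n : (2 ^ (16 ^ n))%:R * weight n <= 1.
Proof.
rewrite /weight expRN ler_pdivrMr ?expR_gt0// mul1r.
have -> : 16 ^+ n = (16 ^ n)%:R :> R by rewrite natrX.
rewrite -[X in expR X]mulr1 expRM_natl natrX lerXn2r ?nnegrE ?expR_ge0//.
by have := expR_ge1Dx (1 : R).
Qed.

Lemma weight_null : null_positive weight.
Proof.
split=> [n|]; first exact: expR_gt0.
have h n : 0 <= weight n <= (2 ^+ n)^-1.
  rewrite expR_ge0 (le_trans _ (weight_decay n))// ler_peMl ?expR_ge0//.
  by rewrite exprn_ege1// ler1n.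
apply: (@squeeze_cvgr _ _ _ _ (cst 0) (fun n => (2 ^+ n)^-1)); first exact: nearW.
  exact: cvg_cst.
rewrite (_ : (fun n => _) = GRing.exp 2^-1).
  by apply: cvg_expr; rewrite ger0_norm ?invr_ge0// invf_lt1// ltr1n.
by apply/funext => n; rewrite exprVn.
Qed.

End weights.

(** * Thinness *)

Theorem proposition2p2 (R : realType) :
  thin (X := L1_01 R) (fun n : nat => expR (- 16 ^+ n)) (@Linfty_ball R).
Proof.
split; first exact: weight_null.
  split; first exact: Linfty_ball_neq0.
  - exists 1; split=> // M M1 f Wf /=.
    by rewrite (le_trans (Linfty_ball_norm_le1 Wf))// ltW.
  - move=> f g p /set_mem Wf /set_mem Wg; apply/mem_set; apply: Linfty_ball_lin => //.
    by rewrite /unstable.onem !ger0_norm ?subr_ge0// addrC subrK.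
  - move=> f Wf; rewrite -[- f]addr0 -scaleN1r -(scale0r f).
    by apply: Linfty_ball_lin => //; rewrite normrN1 normr0 addr0.
move=> Y [Ysub _] Yinf; apply: contrapT => supy.
have [C C0 supC] : exists2 C : R, 0 < C &
    (ereal_sup [set ereal_sup [set thin_norm (X := L1_01 R) (@weight R) (@Linfty_ball R) n y |
       y in Y `&` @closed_unit_ball R (L1_01 R)] | n in [set: nat]] <= C%:E)%E.
  move: supy; case: (ereal_sup _) => [r _|/(_ erefl)//|_].
    exists (`|r| + 1); first by rewrite ltr_wpDl.
    by rewrite lee_fin (le_trans (ler_norm r))// lerDl.
  by exists 1 => //; exact: leNye.
apply: Yinf; apply: (splitting_finite_dimensional (lebesgue01_setT R)
  (@weight_decay R) (@weight_signs R) Ysub (C := C + 1)).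
  by rewrite addr_gt0.
move=> y Yy y1; apply: gauge_le_splits => [n|n]; first exact: expR_gt0.
apply: le_trans supC; apply: le_trans (ereal_sup_ubound _); last by exists n.
by apply: ereal_sup_ubound; exists y.
Qed.
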